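(* Let $\Bbbk$ be a field and $\mathcal{Y}$ a linearly ordered set (possibly infinite) endowed with an involution $\sigma$. The category $\kappa(\mathcal{Y},\Bbbk)$, together with the autofunctor $[-]:\kappa(\mathcal{Y},\Bbbk)\to\kappa(\mathcal{Y},\Bbbk)$ and the family $\tau$ of distinguished triangles, is a triangulated category.
   Context: **Block matrices.** For a block matrix $B=(B_i^j)_{i,j\in\mathcal{Y}}$ with entries in $\Bbbk$ (blocks not necessarily square, possibly empty), the subindex denotes the block row and the superindex the block column; $B_i$ is the $i$-th horizontal band and $B^j$ the $j$-th vertical band. A horizontal partition of $C$ is compatible with the vertical partition of $D$ if for each $x\in\mathcal{Y}$ the number of rows of $C_x$ equals the number of columns of $D^x$. **The category $s(\mathcal{Y},\Bbbk)$.** Objects are finite square block matrices $B=(B_i^j)_{i,j\in\mathcal{Y}}$ over $\Bbbk$ such that: (i) the horizontal and vertical partitions of $B$ are compatible; (ii) if $\sigma(i)=j$, then all matrices in $B_i$ (resp. $B^i$) have the same number of rows (resp. columns) as all matrices in $B_j$ (resp. $B^j$); (iii) $B^2=0$. A morphism $T:B\to C$ is a block matrix $T=(T_i^j)_{i,j\in\mathcal{Y}}$ over $\Bbbk$ such that: (a) the horizontal (resp. vertical) partition of $T$ is compatible with the vertical (resp. horizontal) partition of $B$ (resp. $C$); (b) $TC=BT$; (c) $T_i^j=0$ if $i>j$; (d) $T_i^i=T_j^j$ if $\sigma(i)=j$. Composition is matrix multiplication written in diagrammatic order: for $T:B\to C$ and $S:C\to D$ the composite is $TS:B\to D$. $\mathrm{Id}_B$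 is the identity matrix and $\mathbf{0}_B^C$ the zero matrix $B\to C$. **The category $\kappa(\mathcal{Y},\Bbbk)$.** For morphisms $S,T:B\to C$ in $s(\mathcal{Y},\Bbbk)$, write $S\equiv T$ if there is a block matrix $K$ (a $\kappa$-matrix) such that: the horizontal (resp. vertical) partition of $K$ is compatible with the vertical (resp. horizontal) partition of $B$ (resp. $C$); $S-T=BK+KC$; $K_i^j=0$ if $i>j$; and $K_i^i=K_j^j$ if $\sigma(i)=j$. The category $\kappa(\mathcal{Y},\Bbbk)$ has the same objects as $s(\mathcal{Y},\Bbbk)$ and $\mathrm{Hom}_{\kappa(\mathcal{Y},\Bbbk)}(B,C)=\mathrm{Hom}_{s(\mathcal{Y},\Bbbk)}(B,C)/\equiv$. **Autofunctor.** $[B]=-B$ on objects and $[T]=T$ on morphisms, defining an autofunctor of $s(\mathcal{Y},\Bbbk)$ and an induced one of $\kappa(\mathcal{Y},\Bbbk)$. **Standard and distinguished triangles.** For $T:B\to C$ in $s(\mathcal{Y},\Bbbk)$, $\mathbf{C}_T$ is the object whose $(i,j)$ block is $\begin{pmatrix}-B_i^j & T_i^j\\ 0 & C_i^j\end{pmatrix}$; $\iota_C:C\to\mathbf{C}_T$ has $(i,j)$ block $\begin{pmatrix}(\mathbf{0}_C^B)_i^j & (\mathrm{Id}_C)_i^j\end{pmatrix}$, and $\pi_B:\mathbf{C}_T\to[B]$ has $(i,j)$ block $\begin{pmatrix}(\mathrm{Id}_B)_i^j\\ (\mathbf{0}_C^B)_i^j\end{pmatrix}$. A standard triangle is $B\xrightarrow{T}C\xrightarrow{\iota_C}\mathbf{C}_T\xrightarrow{\pi_B}[B]$.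 A triangle $X\xrightarrow{u}Y\xrightarrow{v}Z\xrightarrow{w}[X]$ in $\kappa(\mathcal{Y},\Bbbk)$ is distinguished if it is isomorphic, as a triangle in $\kappa(\mathcal{Y},\Bbbk)$, to a standard triangle for some morphism $T$ of $s(\mathcal{Y},\Bbbk)$. $\tau$ is the family of all distinguished triangles. *)

(* Defs.v *)
From HB Require Import structures.
From mathcomp Require Import all_boot all_order all_algebra.
From mathcomp Require Import generic_quotient ring_quotient finmap.
From mathcomp Require Import boolp classical_sets functions cardinality fsbigop.

Set Implicit Arguments.
Unset Strict Implicit.
Unset Printing Implicit Defensive.

Import Order.TTheory GRing.Theory.
Local Open Scope ring_scope.

Reserved Notation "f ;; g" (at level 40, left associativity).

(* Composition is written in diagrammatic order throughout: [f ;; g] is f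
   followed by g. *)

Record preaddCat := PreaddCat {
  obj :> Type;
  hom : obj -> obj -> zmodType;
  idm : forall A, hom A A;
  comp : forall A B C, hom A B -> hom B C -> hom A C;
  compA : forall A B C D (f : hom A B) (g : hom B C) (h : hom C D),
    comp f (comp g h) = comp (comp f g) h;
  comp1m : forall A B (f : hom A B), comp (idm A) f = f;
  compm1 : forall A B (f : hom A B), comp f (idm B) = f;
  compDl : forall A B C (f g : hom A B) (h : hom B C),
    comp (f + g) h = comp f h + comp g h;
  compDr : forall A B C (f : hom A B) (g h : hom B C),
    comp f (g + h) = comp f g + comp f h
}.

Arguments hom {p}.
Arguments idm {p}.
Arguments comp {p A B C}.
Notation "f ;; g" := (comp f g).

Section CategoryNotions.
Variable C : preaddCat.

Definition is_iso (A B : C) (f : hom A B) : Prop :=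
  exists g : hom B A, f ;; g = idm A /\ g ;; f = idm B.

Definition is_initial (Z : C) : Prop :=
  forall A, exists f : hom Z A, forall g : hom Z A, g = f.

Definition is_terminal (Z : C) : Prop :=
  forall A, exists f : hom A Z, forall g : hom A Z, g = f.

Definition is_zero (Z : C) : Prop := is_initial Z /\ is_terminal Z.

Definition is_biproduct (A B P : C) (i1 : hom A P) (i2 : hom B P)
    (p1 : hom P A) (p2 : hom P B) : Prop :=
  [/\ i1 ;; p1 = idm A, i2 ;; p2 = idm B & p1 ;; i1 + p2 ;; i2 = idm P].

Definition additive_category : Prop :=
  (exists Z, is_zero Z) /\
  (forall A B : C, exists P (i1 : hom A P) (i2 : hom B P)
     (p1 : hom P A) (p2 : hom P B), is_biproduct i1 i2 p1 p2).

End CategoryNotions.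

Record functor (C D : preaddCat) := Functor {
  fobj :> C -> D;
  fhom : forall A B, hom A B -> hom (fobj A) (fobj B);
  fhom1 : forall A, fhom (idm A) = idm (fobj A);
  fhomM : forall A B E (f : hom A B) (g : hom B E),
    fhom (f ;; g) = fhom f ;; fhom g
}.

Arguments fhom {C D} _ {A B} _.

Definition additive_functor (C D : preaddCat) (F : functor C D) : Prop :=
  forall A B (f g : hom A B), fhom F (f + g) = fhom F f + fhom F g.

(* F has a two-sided inverse functor, strictly (not just up to isomorphism). *)
Definition autofunctor (C : preaddCat) (F : functor C C) : Prop :=
  bijective F /\ (forall A B, bijective (@fhom C C F A B)).

Section Triangles.
Variables (C : preaddCat) (S : functor C C).

Record triangle := Triangle {
  tX : C; tY : C; tZ : C;
  tu : hom tX tY;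
  tv : hom tY tZ;
  tw : hom tZ (S tX)
}.

Definition triangle_iso (t t' : triangle) : Prop :=
  exists (f : hom (tX t) (tX t')) (g : hom (tY t) (tY t'))
         (h : hom (tZ t) (tZ t')),
    [/\ is_iso f, is_iso g & is_iso h] /\
    [/\ tu t ;; g = f ;; tu t',
        tv t ;; h = g ;; tv t' &
        tw t ;; fhom S f = h ;; tw t'].

Record triangulated (D : triangle -> Prop) : Prop := Triangulated {
  tr_additive : additive_category C;
  tr_shift_additive : additive_functor S;
  tr_shift_auto : autofunctor S;
  tr1_iso : forall t t', triangle_iso t t' -> D t -> D t';
  tr1_id : forall X Z : C, is_zero Z ->
    D (Triangle (idm X) (0 : hom X Z) (0 : hom Z (S X)));
  tr1_ex : forall (X Y : C) (u : hom X Y),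
    exists Z (v : hom Y Z) (w : hom Z (S X)), D (Triangle u v w);
  tr2 : forall (X Y Z : C) (u : hom X Y) (v : hom Y Z) (w : hom Z (S X)),
    D (Triangle u v w) <-> D (Triangle v w (- fhom S u));
  tr3 : forall (X Y Z X' Y' Z' : C)
      (u : hom X Y) (v : hom Y Z) (w : hom Z (S X))
      (u' : hom X' Y') (v' : hom Y' Z') (w' : hom Z' (S X'))
      (f : hom X X') (g : hom Y Y'),
    D (Triangle u v w) -> D (Triangle u' v' w') ->
    u ;; g = f ;; u' ->
    exists h : hom Z Z', v ;; h = g ;; v' /\ w ;; fhom S f = h ;; w';
  tr4 : forall (X Y Z X' Y' Z' : C)
      (u : hom X Y) (v : hom Y Z)
      (j : hom Y Z') (k : hom Z' (S X))
      (l : hom Z X') (i : hom X' (S Y))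
      (m : hom Z Y') (n : hom Y' (S X)),
    D (Triangle u j k) -> D (Triangle v l i) -> D (Triangle (u ;; v) m n) ->
    exists (f : hom Z' Y') (g : hom Y' X'),
      D (Triangle f g (i ;; fhom S j)) /\
      [/\ j ;; f = v ;; m, f ;; n = k, m ;; g = l & g ;; i = n ;; fhom S u]
}.

End Triangles.

Record mor_ideal (C : preaddCat) := MorIdeal {
  ideal_at :> forall A B : C, zmodClosed (hom A B);
  ideal_compl : forall (A B D : C) (f : hom A B) (g : hom B D),
    g \in ideal_at B D -> f ;; g \in ideal_at A D;
  ideal_compr : forall (A B D : C) (f : hom A B) (g : hom B D),
    f \in ideal_at A B -> f ;; g \in ideal_at A D
}.

Section QuotientCategory.
Local Open Scope quotient_scope.
Variables (C : preaddCat) (I : mor_ideal C).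
Implicit Types A B D E : C.

Definition qhom (A B : C) : zmodType := Quotient.quot (I A B).

Definition qpi (A B : C) (f : hom A B) : qhom A B := \pi_(Quotient.quot (I A B)) f.

Definition qrepr (A B : C) (f : qhom A B) : hom A B := repr f.

Definition qcomp (A B D : C) (f : qhom A B) (g : qhom B D) : qhom A D :=
  qpi (qrepr f ;; qrepr g).

Lemma qreprK A B (f : qhom A B) : qpi (qrepr f) = f.
Proof. exact: reprK. Qed.

Lemma qpiP A B (f g : hom A B) : qpi f = qpi g <-> f - g \in I A B.
Proof. by rewrite Quotient.idealrBE; split=> /eqP. Qed.

Lemma qpiD A B (f g : hom A B) : qpi (f + g) = qpi f + qpi g.
Proof. by rewrite /qpi !piE. Qed.

Lemma comp0m A B D (g : hom B D) : (0 : hom A B) ;; g = 0.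
Proof. by apply: (addrI (0 ;; g)); rewrite -compDl !addr0. Qed.

Lemma compm0 A B D (g : hom A B) : g ;; (0 : hom B D) = 0.
Proof. by apply: (addrI (g ;; 0)); rewrite -compDr !addr0. Qed.

Lemma compBl A B D (f g : hom A B) (h : hom B D) :
  (f - g) ;; h = f ;; h - g ;; h.
Proof.
rewrite compDl; congr (_ + _); apply/eqP.
by rewrite -addr_eq0 -compDl addNr comp0m.
Qed.

Lemma compBr A B D (f : hom A B) (g h : hom B D) :
  f ;; (g - h) = f ;; g - f ;; h.
Proof.
rewrite compDr; congr (_ + _); apply/eqP.
by rewrite -addr_eq0 -compDr addNr compm0.
Qed.

Lemma qpi_comp A B D (f : hom A B) (g : hom B D) :
  qpi (f ;; g) = qcomp (qpi f) (qpi g).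
Proof.
apply/qpiP.
have hf := (qpiP f _).1 (esym (qreprK (qpi f))).
have hg := (qpiP g _).1 (esym (qreprK (qpi g))).
rewrite -[X in X - _](subrK (qrepr (qpi f) ;; g)) -compBl -addrA -compBr.
by apply: rpredD; [exact: ideal_compr|exact: ideal_compl].
Qed.

Definition quot_cat : preaddCat.
Proof.
refine (@PreaddCat (obj C) qhom (fun A => qpi (idm A)) qcomp _ _ _ _ _).
- move=> A B D E f g h; rewrite -[f]qreprK -[g]qreprK -[h]qreprK.
  by rewrite -!qpi_comp compA.
- by move=> A B f; rewrite -[f]qreprK -qpi_comp comp1m.
- by move=> A B f; rewrite -[f]qreprK -qpi_comp compm1.
- move=> A B D f g h; rewrite -[f]qreprK -[g]qreprK -[h]qreprK.
  by rewrite -!qpi_comp -!qpiD -qpi_comp compDl.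
- move=> A B D f g h; rewrite -[f]qreprK -[g]qreprK -[h]qreprK.
  by rewrite -!qpi_comp -!qpiD -qpi_comp compDr.
Defined.

Variable F : functor C C.
Hypothesis F_additive : additive_functor F.
Hypothesis F_ideal : forall A B (f : hom A B),
  f \in I A B -> fhom F f \in I (F A) (F B).

Definition quot_fhom (A B : C) (f : qhom A B) : qhom (F A) (F B) :=
  qpi (fhom F (qrepr f)).

Lemma quot_fhomE A B (f : hom A B) : quot_fhom (qpi f) = qpi (fhom F f).
Proof.
apply/qpiP; set r := qrepr _.
have /F_ideal := (qpiP r f).1 (qreprK (qpi f)).
suff -> : fhom F (r - f) = fhom F r - fhom F f by [].
apply: (addIr (fhom F f)); rewrite -F_additive.
by rewrite !subrK.
Qed.

Definition quot_functor : functor quot_cat quot_cat.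
Proof.
refine (@Functor quot_cat quot_cat (fobj F) quot_fhom _ _).
- by move=> A; rewrite /= quot_fhomE fhom1.
- move=> A B D f g; rewrite -[f]qreprK -[g]qreprK.
  by rewrite /= -qpi_comp !quot_fhomE fhomM qpi_comp.
Defined.

End QuotientCategory.

(* A family of block sizes is a function Y -> nat; the (i, j) block of a matrix
   has d i rows and e j columns. *)
Definition blockmx (k : fieldType) (Y : Type) (d e : Y -> nat) : Type :=
  forall i j : Y, 'M[k]_(d i, e j).

Section BlockMatrices.
Variables (k : fieldType) (disp : Order.disp_t) (Y : orderType disp).
Implicit Types d e f g : Y -> nat.
Local Notation blockmx := (@blockmx k Y).

Section Zmod.
Variables d e : Y -> nat.

HB.instance Definition _ := gen_eqMixin (blockmx d e).
HB.instance Definition _ := gen_choiceMixin (blockmx d e).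

Definition bmx0 : blockmx d e := fun i j => 0.
Definition bmxD (T S : blockmx d e) : blockmx d e := fun i j => T i j + S i j.
Definition bmxN (T : blockmx d e) : blockmx d e := fun i j => - T i j.

Lemma bmxP (T S : blockmx d e) : (forall i j, T i j = S i j) -> T = S.
Proof. by move=> TS; apply: functional_extensionality_dep => i;
  apply: functional_extensionality_dep => j. Qed.

Fact bmxDA : associative bmxD.
Proof. by move=> *; apply: bmxP => i j; exact: addrA. Qed.
Fact bmxDC : commutative bmxD.
Proof. by move=> *; apply: bmxP => i j; exact: addrC. Qed.
Fact bmx0D : left_id bmx0 bmxD.
Proof. by move=> *; apply: bmxP => i j; exact: add0r. Qed.
Fact bmxND : left_inverse bmx0 bmxN bmxD.
Proof. by move=> *; apply: bmxP => i j; exact: addNr. Qed.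

HB.instance Definition _ :=
  GRing.isZmodule.Build (blockmx d e) bmxDA bmxDC bmx0D bmxND.

Lemma bmx0E i j : (0 : blockmx d e) i j = 0. Proof. by []. Qed.
Lemma bmxDE (T S : blockmx d e) i j : (T + S) i j = T i j + S i j.
Proof. by []. Qed.
Lemma bmxNE (T : blockmx d e) i j : (- T) i j = - T i j.
Proof. by []. Qed.

End Zmod.

Definition finite_dim d : Prop := finite_set [set i | d i != 0%N].

(* The index l ranges over all of Y, but the summand vanishes when e l = 0. *)
Definition bmul d e f (T : blockmx d e) (S : blockmx e f) : blockmx d f :=
  fun i j => \sum_(l \in [set: Y]) (T i l *m S l j).

Definition bid d : blockmx d d := fun i j =>
  \matrix_(a, b) ((i == j) && (a == b :> nat))%:R.

Definition upper_triangular d e (T : blockmx d e) : Prop :=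
  forall i j, (j < i)%O -> T i j = 0.

(* Equality of matrices whose sizes are not the same expression. *)
Definition eq_mx m n m' n' (A : 'M[k]_(m, n)) (B : 'M[k]_(m', n')) : Prop :=
  exists e : (m = m') * (n = n'), castmx e A = B.

Definition sigma_diag (sigma : Y -> Y) d e (T : blockmx d e) : Prop :=
  forall i j, sigma i = j -> eq_mx (T i i) (T j j).

Lemma bmulE d e f (T : blockmx d e) (S : blockmx e f) (X : {fset Y}) i j :
  (forall l, l \notin X -> e l = 0%N) ->
  bmul T S i j = \sum_(l <- X) (T i l *m S l j).
Proof.
move=> eX; rewrite /bmul (fsbigTE X) // => l /eX el0.
apply/matrixP => a b; rewrite !mxE big1 // => c _.
by case: c => c lc; exfalso; move: lc; rewrite el0.
Qed.

Lemma finite_dimP d : finite_dim d ->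
  exists X : {fset Y}, forall l, l \notin X -> d l = 0%N.
Proof.
move=> fd; exists (fset_set [set i | d i != 0%N]) => l.
rewrite in_fset_set // => /negP lX; apply/eqP; apply: contrapT => dl.
by apply: lX; rewrite inE; apply/negP.
Qed.

Lemma bmulA d e f g (T : blockmx d e) (S : blockmx e f) (R : blockmx f g) :
  finite_dim e -> finite_dim f -> bmul T (bmul S R) = bmul (bmul T S) R.
Proof.
move=> /finite_dimP[X eX] /finite_dimP[X' fX]; apply: bmxP => i j.
rewrite (bmulE _ _ _ _ eX) (bmulE _ _ _ _ fX).
under eq_bigr do rewrite (bmulE _ _ _ _ fX) mulmx_sumr.
under [RHS]eq_bigr do rewrite (bmulE _ _ _ _ eX) mulmx_suml.
rewrite exchange_big /=; apply: eq_bigr => l _; apply: eq_bigr => l' _.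
exact: mulmxA.
Qed.

Lemma bmulDl d e f (T S : blockmx d e) (R : blockmx e f) :
  finite_dim e -> bmul (T + S) R = bmul T R + bmul S R.
Proof.
move=> /finite_dimP[X eX]; apply: bmxP => i j.
rewrite bmxDE !(bmulE _ _ _ _ eX) -big_split /=.
by apply: eq_bigr => l _; rewrite bmxDE mulmxDl.
Qed.

Lemma bmulDr d e f (T : blockmx d e) (S R : blockmx e f) :
  finite_dim e -> bmul T (S + R) = bmul T S + bmul T R.
Proof.
move=> /finite_dimP[X eX]; apply: bmxP => i j.
rewrite bmxDE !(bmulE _ _ _ _ eX) -big_split /=.
by apply: eq_bigr => l _; rewrite bmxDE mulmxDr.
Qed.

Lemma bmulNl d e f (T : blockmx d e) (S : blockmx e f) :
  finite_dim e -> bmul (- T) S = - bmul T S.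
Proof.
move=> /finite_dimP[X eX]; apply: bmxP => i j.
rewrite bmxNE !(bmulE _ _ _ _ eX) -sumrN.
by apply: eq_bigr => l _; rewrite bmxNE mulNmx.
Qed.

Lemma bmulNr d e f (T : blockmx d e) (S : blockmx e f) :
  finite_dim e -> bmul T (- S) = - bmul T S.
Proof.
move=> /finite_dimP[X eX]; apply: bmxP => i j.
rewrite bmxNE !(bmulE _ _ _ _ eX) -sumrN.
by apply: eq_bigr => l _; rewrite bmxNE mulmxN.
Qed.

Lemma bmul0r d e f (T : blockmx d e) : bmul T (0 : blockmx e f) = 0.
Proof. by apply: bmxP => i j; apply: fsbig1 => l _; rewrite mulmx0. Qed.

Lemma bmul0l d e f (T : blockmx e f) : bmul (0 : blockmx d e) T = 0.
Proof. by apply: bmxP => i j; apply: fsbig1 => l _; rewrite mul0mx. Qed.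

Lemma bid_diag d i : bid d i i = 1%:M.
Proof. by apply/matrixP => a b; rewrite !mxE eqxx. Qed.

Lemma bid_off d i j : i != j -> bid d i j = 0.
Proof. by move=> /negPf ij; apply/matrixP => a b; rewrite !mxE ij. Qed.

Lemma bmul_single d e f (T : blockmx d e) (S : blockmx e f) i j l :
  (forall l', l' != l -> T i l' *m S l' j = 0) ->
  bmul T S i j = T i l *m S l j.
Proof.
move=> TS; rewrite /bmul (fsbigTE [fset l]%fset).
  by rewrite big_seq_fset1.
by move=> l'; rewrite inE => /TS.
Qed.

Lemma bmul1l d e (T : blockmx d e) : bmul (bid d) T = T.
Proof.
apply: bmxP => i j; rewrite (bmul_single (l := i)) ?bid_diag ?mul1mx //.
by move=> l li; rewrite bid_off ?mul0mx // eq_sym.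
Qed.

Lemma bmul1r d e (T : blockmx d e) : bmul T (bid e) = T.
Proof.
apply: bmxP => i j; rewrite (bmul_single (l := j)) ?bid_diag ?mulmx1 //.
by move=> l li; rewrite bid_off ?mulmx0.
Qed.

Lemma upper_triangular0 d e : upper_triangular (0 : blockmx d e).
Proof. by []. Qed.

Lemma upper_triangularB d e (T S : blockmx d e) :
  upper_triangular T -> upper_triangular S -> upper_triangular (T - S).
Proof. by move=> hT hS i j ji; rewrite bmxDE bmxNE hT ?hS ?subrr. Qed.

Lemma upper_triangularM d e f (T : blockmx d e) (S : blockmx e f) :
  upper_triangular T -> upper_triangular S -> upper_triangular (bmul T S).
Proof.
move=> hT hS i j ji; apply: fsbig1 => l _.
have [li|il] := ltP l i; first by rewrite hT ?mul0mx.
by rewrite hS ?mulmx0 // (lt_le_trans ji).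
Qed.

Lemma upper_triangular1 d : upper_triangular (bid d).
Proof. by move=> i j ji; rewrite bid_off // gt_eqF. Qed.

Lemma diag_bmul d e f (T : blockmx d e) (S : blockmx e f) i :
  upper_triangular T -> upper_triangular S ->
  bmul T S i i = T i i *m S i i.
Proof.
move=> hT hS; rewrite (bmul_single (l := i)) // => l.
by rewrite neq_lt => /orP[li|il]; [rewrite hT ?mul0mx|rewrite hS ?mulmx0].
Qed.

Lemma eq_mxB m n m' n' (A B : 'M[k]_(m, n)) (A' B' : 'M[k]_(m', n')) :
  eq_mx A A' -> eq_mx B B' -> eq_mx (A - B) (A' - B').
Proof.
move=> [e <-] [e' <-]; exists e; case: e e' => e1 e2 [e3 e4].
by subst m' n'; rewrite !castmx_id.
Qed.

Lemma eq_mxM m n p m' n' p' (A : 'M[k]_(m, n)) (B : 'M[k]_(n, p))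
    (A' : 'M[k]_(m', n')) (B' : 'M[k]_(n', p')) :
  eq_mx A A' -> eq_mx B B' -> eq_mx (A *m B) (A' *m B').
Proof.
move=> [[em en] <-] [[en' ep] <-]; exists (em, ep).
by subst m' n' p'; rewrite !castmx_id.
Qed.

Section SigmaDiag.
Variables (sigma : Y -> Y) (d e f : Y -> nat).
Hypothesis d_sigma : forall i j, sigma i = j -> d i = d j.
Hypothesis e_sigma : forall i j, sigma i = j -> e i = e j.

Lemma sigma_diag0 : sigma_diag sigma (0 : blockmx d e).
Proof.
move=> i j ij; exists (d_sigma ij, e_sigma ij).
by apply/matrixP => a b; rewrite castmxE !mxE.
Qed.

Lemma sigma_diagB (T S : blockmx d e) :
  sigma_diag sigma T -> sigma_diag sigma S -> sigma_diag sigma (T - S).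
Proof. by move=> hT hS i j ij; apply: eq_mxB; [exact: hT|exact: hS]. Qed.

Lemma sigma_diagM (T : blockmx d e) (S : blockmx e f) :
  upper_triangular T -> upper_triangular S ->
  sigma_diag sigma T -> sigma_diag sigma S -> sigma_diag sigma (bmul T S).
Proof.
move=> uT uS hT hS i j ij; rewrite !diag_bmul //.
by apply: eq_mxM; [exact: hT|exact: hS].
Qed.

Lemma sigma_diag1 : sigma_diag sigma (bid d).
Proof.
move=> i j ij; exists (d_sigma ij, d_sigma ij).
by apply/matrixP => a b; rewrite castmxE !mxE !eqxx.
Qed.

End SigmaDiag.
End BlockMatrices.

Section CategoryS.
Variables (k : fieldType) (disp : Order.disp_t) (Y : orderType disp).
Variable sigma : Y -> Y.
Local Notation blockmx := (@blockmx k Y).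

(* Compatibility of the two partitions is built in: rows and columns share
   [dim].  Finiteness of the matrix is [dim_finite]. *)
Record sobj := SObj {
  dim : Y -> nat;
  bmx : blockmx dim dim;
  dim_finite : finite_dim dim;
  dim_sigma : forall i j, sigma i = j -> dim i = dim j;
  bmx_sq0 : bmul bmx bmx = 0
}.

Definition is_smor (B C : sobj) (T : blockmx (dim B) (dim C)) : Prop :=
  [/\ bmul T (bmx C) = bmul (bmx B) T,
      upper_triangular T & sigma_diag sigma T].

Section Hom.
Variables B C : sobj.

Definition smor_pred : {pred blockmx (dim B) (dim C)} := fun T => `[< is_smor T >].

Fact smor_zmod_closed : zmod_closed smor_pred.
Proof.
split=> [|T S /asboolP[T1 T2 T3] /asboolP[S1 S2 S3]]; apply/asboolP; split.
- by rewrite bmul0l bmul0r.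
- exact: upper_triangular0.
- exact: sigma_diag0 (@dim_sigma B) (@dim_sigma C).
- rewrite bmulDl ?bmulDr ?bmulNl ?bmulNr ?T1 ?S1 //; exact: dim_finite.
- exact: upper_triangularB.
- exact: sigma_diagB.
Qed.

HB.instance Definition _ :=
  GRing.isZmodClosed.Build (blockmx (dim B) (dim C)) smor_pred smor_zmod_closed.

Record smor := SMor { mx_of : blockmx (dim B) (dim C); _ : mx_of \in smor_pred }.

HB.instance Definition _ := [isSub for mx_of].
HB.instance Definition _ := [Choice of smor by <:].
HB.instance Definition _ := [SubChoice_isSubZmodule of smor by <:].

Lemma smorP (T : smor) : is_smor (mx_of T).
Proof. by apply/asboolP; exact: (valP T). Qed.

Definition smor_of (T : blockmx (dim B) (dim C)) (hT : is_smor T) : smor :=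
  SMor (introT (asboolP (is_smor T)) hT).

Lemma mx_of_inj : injective mx_of. Proof. exact: val_inj. Qed.
Lemma mx_ofD (T S : smor) : mx_of (T + S) = mx_of T + mx_of S.
Proof. by []. Qed.
Lemma mx_ofB (T S : smor) : mx_of (T - S) = mx_of T - mx_of S.
Proof. by []. Qed.
Lemma mx_of0 : mx_of 0 = 0. Proof. by []. Qed.

End Hom.

Lemma is_smor_id (B : sobj) : is_smor (B := B) (C := B) (bid k (dim B)).
Proof.
split; first by rewrite bmul1l bmul1r.
  exact: upper_triangular1.
by apply: sigma_diag1; exact: dim_sigma.
Qed.

Lemma is_smor_comp (B C D : sobj) (T : smor B C) (S : smor C D) :
  is_smor (B := B) (C := D) (bmul (mx_of T) (mx_of S)).
Proof.
case: (smorP T) (smorP S) => T1 T2 T3 [S1 S2 S3]; split.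
- rewrite -bmulA ?S1 ?bmulA ?T1 //; exact: dim_finite.
- exact: upper_triangularM.
- exact: sigma_diagM.
Qed.

Definition smor_id (B : sobj) : smor B B := smor_of (is_smor_id B).
Definition smor_comp (B C D : sobj) (T : smor B C) (S : smor C D) : smor B D :=
  smor_of (is_smor_comp T S).

Definition s_cat : preaddCat.
Proof.
refine (@PreaddCat sobj (fun B C => smor B C) smor_id smor_comp _ _ _ _ _);
  move=> *; apply: mx_of_inj => /=.
- apply: bmulA; exact: dim_finite.
- exact: bmul1l.
- exact: bmul1r.
- apply: bmulDl; exact: dim_finite.
- apply: bmulDr; exact: dim_finite.
Defined.

Definition kappa_matrix (B C : sobj) (T : smor B C)
    (K : blockmx (dim B) (dim C)) : Prop :=
  [/\ mx_of T = bmul (bmx B) K + bmul K (bmx C),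
      upper_triangular K & sigma_diag sigma K].

Definition null (B C : sobj) : {pred smor B C} :=
  fun T => `[< exists K, kappa_matrix T K >].

Fact null_zmod_closed B C : zmod_closed (@null B C).
Proof.
split=> [|T S /asboolP[K [K1 K2 K3]] /asboolP[L [L1 L2 L3]]]; apply/asboolP.
  exists 0; split; first by rewrite bmul0l bmul0r addr0.
    exact: upper_triangular0.
  exact: sigma_diag0 (@dim_sigma B) (@dim_sigma C).
exists (K - L); split; last exact: sigma_diagB.
  rewrite mx_ofB K1 L1 bmulDl ?bmulDr ?bmulNl ?bmulNr; try exact: dim_finite.
  by rewrite opprD addrACA.
exact: upper_triangularB.
Qed.

HB.instance Definition _ B C :=
  GRing.isZmodClosed.Build (smor B C) (@null B C) (@null_zmod_closed B C).

Fact null_compl (B C D : s_cat) (T : hom B C) (S : hom C D) :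
  S \in @null C D -> T ;; S \in @null B D.
Proof.
case: (smorP T) => T1 T2 T3 /asboolP[K [K1 K2 K3]]; apply/asboolP.
exists (bmul (mx_of T) K); split; last exact: sigma_diagM.
  rewrite /= K1 bmulDr; last exact: dim_finite.
  rewrite !bmulA ?T1 //; exact: dim_finite.
exact: upper_triangularM.
Qed.

Fact null_compr (B C D : s_cat) (T : hom B C) (S : hom C D) :
  T \in @null B C -> T ;; S \in @null B D.
Proof.
case: (smorP S) => S1 S2 S3 /asboolP[K [K1 K2 K3]]; apply/asboolP.
exists (bmul K (mx_of S)); split; last exact: sigma_diagM.
  rewrite /= K1 bmulDl; last exact: dim_finite.
  rewrite -!bmulA ?S1 //; exact: dim_finite.
exact: upper_triangularM.
Qed.

Definition null_ideal : mor_ideal s_cat :=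
  @MorIdeal s_cat (fun B C => @null B C) null_compl null_compr.

(* Two morphisms S, T : B -> C are identified when S - T is in [null B C], i.e.
   when S - T = B K + K C for some kappa-matrix K. *)
Definition kappa_cat : preaddCat := quot_cat null_ideal.

Fact shift_sq0 (B : sobj) : bmul (- bmx B) (- bmx B) = 0.
Proof.
by rewrite bmulNl ?bmulNr ?opprK ?bmx_sq0 //; exact: dim_finite.
Qed.

Definition shift_obj (B : sobj) : sobj :=
  @SObj (dim B) (- bmx B) (@dim_finite B) (@dim_sigma B) (shift_sq0 B).

Fact is_smor_shift (B C : sobj) (T : smor B C) :
  is_smor (B := shift_obj B) (C := shift_obj C) (mx_of T).
Proof.
case: (smorP T) => T1 T2 T3; split=> //=.
by rewrite bmulNl ?bmulNr ?T1 //; exact: dim_finite.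
Qed.

Definition shift_mor (B C : sobj) (T : smor B C) :
  smor (shift_obj B) (shift_obj C) := smor_of (is_smor_shift T).

Definition s_shift : functor s_cat s_cat.
Proof.
by refine (@Functor s_cat s_cat shift_obj shift_mor _ _);
  move=> *; apply: mx_of_inj.
Defined.

Fact s_shift_additive : additive_functor s_shift.
Proof. by move=> B C T S; apply: mx_of_inj. Qed.

Fact s_shift_null (B C : s_cat) (T : hom B C) :
  T \in null_ideal B C -> fhom s_shift T \in null_ideal (s_shift B) (s_shift C).
Proof.
move=> /asboolP[K [K1 K2 K3]]; apply/asboolP; exists (- K); split=> /=.
- by rewrite !(bmulNl, bmulNr) ?opprK //; exact: dim_finite.
- by rewrite -[- K]add0r; apply: upper_triangularB.
- rewrite -[- K]add0r; apply: sigma_diagB => //.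
  exact: sigma_diag0 (@dim_sigma B) (@dim_sigma C).
Qed.

Definition kappa_shift : functor kappa_cat kappa_cat :=
  quot_functor s_shift_additive s_shift_null.

Section Cone.
Variables (B C : sobj) (T : smor B C).

Definition cone_dim (i : Y) : nat := (dim B i + dim C i)%N.

Definition cone_bmx : blockmx cone_dim cone_dim := fun i j =>
  block_mx (- bmx B i j) (mx_of T i j) 0 (bmx C i j).

Fact cone_dim_finite : finite_dim cone_dim.
Proof.
have : finite_set ([set i | dim B i != 0%N] `|` [set i | dim C i != 0%N])%classic.
  by rewrite finite_setU; split; exact: dim_finite.
apply: sub_finite_set => i /=; rewrite /cone_dim addn_eq0 negb_and.
by move=> /orP.
Qed.

Fact cone_dim_sigma i j : sigma i = j -> cone_dim i = cone_dim j.
Proof. by move=> ij; rewrite /cone_dim (dim_sigma B ij) (dim_sigma C ij). Qed.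

Fact cone_sq0 : bmul cone_bmx cone_bmx = 0.
Proof.
case: (smorP T) => T1 _ _.
have [X BX] := finite_dimP (dim_finite B).
have [X' CX] := finite_dimP (dim_finite C).
have BU l : l \notin (X `|` X')%fset -> dim B l = 0%N.
  by rewrite inE negb_or => /andP[/BX].
have CU l : l \notin (X `|` X')%fset -> dim C l = 0%N.
  by rewrite inE negb_or => /andP[_ /CX].
have TU l : l \notin (X `|` X')%fset -> cone_dim l = 0%N.
  by move=> lU; rewrite /cone_dim BU ?CU.
apply: bmxP => i j; rewrite (bmulE _ _ _ _ TU).
under eq_bigr do rewrite mulmx_block !mulmx0 !mul0mx !addr0 add0r mulNmx mulmxN opprK mulNmx.
have blk (s : seq Y) (P : Y -> 'M[k]_(dim B i, dim B j)) Q R :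
    \sum_(l <- s) block_mx (P l) (Q l) 0 (R l) =
    block_mx (\sum_(l <- s) P l) (\sum_(l <- s) Q l) 0 (\sum_(l <- s) R l)
      :> 'M[k]_(dim B i + dim C i, dim B j + dim C j).
  elim: s => [|l s IH]; first by rewrite !big_nil -[0]block_mx0.
  by rewrite !big_cons IH add_block_mx addr0.
rewrite blk -!(bmulE _ _ _ _ BU) -!(bmulE _ _ _ _ CU) !bmx_sq0.
rewrite big_split sumrN /= -(bmulE _ _ _ _ BU) -(bmulE _ _ _ _ CU) T1 addNr.
exact: block_mx0.
Qed.

Definition cone : sobj :=
  @SObj cone_dim cone_bmx cone_dim_finite cone_dim_sigma cone_sq0.

Definition cone_in_mx : blockmx (dim C) (dim cone) :=
  fun i j => row_mx 0 (bid k (dim C) i j).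

Definition cone_out_mx : blockmx (dim cone) (dim B) :=
  fun i j => col_mx (bid k (dim B) i j) 0.

Fact is_smor_cone_in : is_smor (B := C) (C := cone) cone_in_mx.
Proof.
split.
- apply: bmxP => i j.
  rewrite (bmul_single (l := i)) => [|l li]; last first.
    by rewrite /cone_in_mx bid_off 1?eq_sym // row_mx0 mul0mx.
  rewrite [RHS](bmul_single (l := j)) => [|l li]; last first.
    by rewrite /cone_in_mx bid_off // row_mx0 mulmx0.
  rewrite /cone_in_mx !bid_diag /= mul_mx_row mulmx0 mulmx1.
  by rewrite mul_row_block !mul0mx !add0r !mul1mx.
- by move=> i j ji; rewrite /cone_in_mx upper_triangular1 // row_mx0.
- move=> i j ij; exists (dim_sigma C ij, cone_dim_sigma ij).
  rewrite /cone_in_mx !bid_diag.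
  move: (dim_sigma C ij : dim C i = dim C j) (cone_dim_sigma ij).
  rewrite /= /cone_dim; move: (dim_sigma B ij : dim B i = dim B j).
  case: (dim B j) /; case: (dim C j) / => e; by rewrite castmx_id.
Qed.

Fact is_smor_cone_out : is_smor (B := cone) (C := shift_obj B) cone_out_mx.
Proof.
split.
- apply: bmxP => i j.
  rewrite (bmul_single (l := i)) => [|l li]; last first.
    by rewrite /cone_out_mx bid_off 1?eq_sym // col_mx0 mul0mx.
  rewrite [RHS](bmul_single (l := j)) => [|l li]; last first.
    by rewrite /cone_out_mx bid_off // col_mx0 mulmx0.
  rewrite /cone_out_mx !bid_diag /= mul_col_mx mul0mx mul1mx.
  by rewrite mul_block_col !mulmx0 !addr0 !mulmx1.
- by move=> i j ji; rewrite /cone_out_mx upper_triangular1 // col_mx0.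
- move=> i j ij; exists (cone_dim_sigma ij, dim_sigma B ij).
  rewrite /cone_out_mx !bid_diag.
  move: (dim_sigma B ij : dim B i = dim B j) (cone_dim_sigma ij).
  rewrite /= /cone_dim; move: (dim_sigma C ij : dim C i = dim C j).
  case: (dim C j) /; case: (dim B j) / => e; by rewrite castmx_id.
Qed.

Definition cone_in : smor C cone := smor_of is_smor_cone_in.
Definition cone_out : smor cone (shift_obj B) := smor_of is_smor_cone_out.

Definition standard_triangle : triangle kappa_shift :=
  @Triangle kappa_cat kappa_shift B C cone
    (qpi null_ideal (A := B) (B := C) T)
    (qpi null_ideal (A := C) (B := cone) cone_in)
    (qpi null_ideal (A := cone) (B := shift_obj B) cone_out).

End Cone.

Definition distinguished (t : triangle kappa_shift) : Prop :=
  exists (B C : sobj) (T : smor B C), triangle_iso t (standard_triangle T).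

End CategoryS.

(* Main.v *)
(* Write a map of cones as a 2x2 block matrix.  If u g - f u' = B K + K C', then
   [[f, K], [0, g]] maps the cone of u to the cone of u'.  A map phi into a cone
   whose composite with the projection is null, via K, is homotopic to one that
   factors through the inclusion, its second component being phi_2 - K T; so an
   endomorphism e of a cone fixing the inclusion and the projection satisfies
   (e - 1)^2 = 0 and is invertible.  Hence isomorphisms f, g between the
   bases of two distinguished triangles extend to the third vertex, and a
   triangle with base u is distinguished iff it is isomorphic to the standard triangle of
   any matrix representing u, by an isomorphism that is the identity on the base.

   Rotation of the standard triangle of T : B -> C is given by the homotopy
   equivalence (-T, 1, 0) from [B] to the cone of the inclusion of C.  Rotating
   backwards amounts to rotating twice more and undoing [-], which is possible
   because [-] is strictly bijective and the cones of [T] and T differ by the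
   sign matrix diag(-1, 1).  For the octahedron, the maps between the three
   cones are [[1, 0], [0, v]] and [[u, 0], [0, 1]], and the cone of the former
   retracts onto the cone of v. *)

From mathcomp Require Import all_boot all_order all_algebra.
From mathcomp Require Import generic_quotient ring_quotient finmap.
From mathcomp Require Import boolp classical_sets functions cardinality fsbigop.
Require Import Defs.

Set Implicit Arguments.
Unset Strict Implicit.
Unset Printing Implicit Defensive.

Import Order.TTheory GRing.Theory.
Local Open Scope ring_scope.

(** * Isomorphisms and zero objects in a preadditive category *)

Section PreadditiveCategories.
Variable C : preaddCat.
Implicit Types X Y Z : C.

Lemma compNm X Y Z (f : hom X Y) (g : hom Y Z) : (- f) ;; g = - (f ;; g).
Proof. by rewrite -[- f]add0r compBl comp0m add0r. Qed.

Lemma compmN X Y Z (f : hom X Y) (g : hom Y Z) : f ;; (- g) = - (f ;; g).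
Proof. by rewrite -[- g]add0r compBr compm0 add0r. Qed.

Lemma is_iso_id X : is_iso (idm X).
Proof. by exists (idm X); rewrite comp1m. Qed.

Lemma is_iso_comp X Y Z (f : hom X Y) (g : hom Y Z) :
  is_iso f -> is_iso g -> is_iso (f ;; g).
Proof.
move=> [f' [ff' f'f]] [g' [gg' g'g]]; exists (g' ;; f'); split.
  by rewrite -compA (compA g) gg' comp1m.
by rewrite -compA (compA f') f'f comp1m.
Qed.

Lemma is_isoN X Y (f : hom X Y) : is_iso f -> is_iso (- f).
Proof.
by move=> [f' [ff' f'f]]; exists (- f'); rewrite !compNm !compmN !opprK.
Qed.

(** With [a] and [b] inverting the two composites, [g ;; a] is a right inverse of [f] and [b ;; g] a
    left one, so they coincide. This reduces [cone_iso] to endomorphisms of cones. *)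
Lemma is_iso_split X Y (f : hom X Y) (g : hom Y X) :
  is_iso (f ;; g) -> is_iso (g ;; f) -> is_iso f.
Proof.
move=> [a [ra _]] [b [_ lb]].
have e : b ;; g = g ;; a.
  by rewrite -[LHS]compm1 -ra -!compA (compA g f) (compA b) lb comp1m.
by exists (g ;; a); rewrite compA ra -e -compA lb.
Qed.

(** For d = e - 1 with d^2 = 0, the inverse of 1 + d is 1 - d. *)
Lemma is_iso_unipotent X (e : hom X X) :
  (e - idm X) ;; (e - idm X) = 0 -> is_iso e.
Proof.
have -> : e = idm X + (e - idm X) by rewrite addrC subrK.
rewrite addrAC subrr add0r; move: (e - idm X) => d dd.
exists (idm X - d); split.
  by rewrite compDl !compBr !comp1m compm1 dd subr0 subrK.
by rewrite compDr !compBl !comp1m compm1 dd subr0 subrK.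
Qed.

Lemma initial_eq X Y (f g : hom X Y) : is_initial X -> f = g.
Proof. by move=> /(_ Y)[h hP]; rewrite (hP f) (hP g). Qed.

Lemma terminal_eq X Y (f g : hom X Y) : is_terminal Y -> f = g.
Proof. by move=> /(_ X)[h hP]; rewrite (hP f) (hP g). Qed.

Lemma is_zero_id0 X : idm X = 0 -> is_zero X.
Proof.
move=> X0; split=> A; exists 0 => g.
  by rewrite -[g]comp1m X0 comp0m.
by rewrite -[g]compm1 X0 compm0.
Qed.

End PreadditiveCategories.

(** * Isomorphism, rotation and shift of triangles *)

Section TriangleIso.
Variables (C : preaddCat) (S : functor C C).
Implicit Types t : triangle S.

Lemma fhom_iso (X Y : C) (f : hom X Y) : is_iso f -> is_iso (fhom S f).
Proof. by move=> [g [fg gf]]; exists (fhom S g); rewrite -!fhomM fg gf !fhom1. Qed.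

Lemma triangle_isoI (X Y Z X' Y' Z' : C)
    (u : hom X Y) (v : hom Y Z) (w : hom Z (S X))
    (u' : hom X' Y') (v' : hom Y' Z') (w' : hom Z' (S X'))
    (f : hom X X') (g : hom Y Y') (h : hom Z Z') :
  is_iso f -> is_iso g -> is_iso h ->
  u ;; g = f ;; u' -> v ;; h = g ;; v' -> w ;; fhom S f = h ;; w' ->
  triangle_iso (Triangle u v w) (Triangle u' v' w').
Proof. by move=> *; exists f, g, h. Qed.

Lemma triangle_iso_refl t : triangle_iso t t.
Proof.
exists (idm _), (idm _), (idm _); split; first by split; exact: is_iso_id.
by rewrite fhom1 !comp1m !compm1.
Qed.

Lemma triangle_iso_sym t t' : triangle_iso t t' -> triangle_iso t' t.
Proof.
move=> [f [g [h [[[f' [ff' f'f]] [g' [gg' g'g]] [h' [hh' h'h]]] [e1 e2 e3]]]]].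
exists f', g', h'; split.
  by split; [exists f|exists g|exists h].
split.
- by rewrite -[tu t']comp1m -f'f -(compA f') -e1 -!compA gg' compm1.
- by rewrite -[tv t']comp1m -g'g -(compA g') -e2 -!compA hh' compm1.
- rewrite -[tw t']comp1m -h'h -(compA h') -e3 -!compA -fhomM ff' fhom1.
  by rewrite compm1.
Qed.

Lemma triangle_iso_trans t t' t'' :
  triangle_iso t t' -> triangle_iso t' t'' -> triangle_iso t t''.
Proof.
move=> [f [g [h [[If Ig Ih] [e1 e2 e3]]]]].
move=> [f' [g' [h' [[If' Ig' Ih'] [e1' e2' e3']]]]].
exists (f ;; f'), (g ;; g'), (h ;; h'); split; first by split; exact: is_iso_comp.
by rewrite fhomM !compA e1 e2 e3 -!compA e1' e2' e3'.
Qed.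

Definition rotate t : triangle S := Triangle (tv t) (tw t) (- fhom S (tu t)).

(** The signs are those that three rotations produce, so that [rotate3] holds by conversion. *)
Definition shift_triangle t : triangle S :=
  Triangle (- fhom S (tu t)) (- fhom S (tv t)) (- fhom S (tw t)).

Lemma rotate_iso t t' : triangle_iso t t' -> triangle_iso (rotate t) (rotate t').
Proof.
move=> [f [g [h [[If Ig Ih] [e1 e2 e3]]]]]; exists g, h, (fhom S f).
split; first by split=> //; exact: fhom_iso.
by split=> //=; rewrite compNm compmN -!fhomM e1.
Qed.

Lemma rotate3 t : rotate (rotate (rotate t)) = shift_triangle t.
Proof. by []. Qed.

(** The functor is bijective on hom sets, so the three components lift together with their inverses,
    and the squares are reflected once the signs are cancelled. *)
Lemma shift_triangle_iso t t' : additive_functor S -> autofunctor S ->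
  triangle_iso (shift_triangle t) (shift_triangle t') -> triangle_iso t t'.
Proof.
move=> addS [_ bijS] [f [g [h [[If Ig Ih] /= [e1 e2 e3]]]]].
have injS (X Y : C) : injective (@fhom C C S X Y).
  by case: (bijS X Y) => i /can_inj.
have lift (X Y : C) (a : hom (S X) (S Y)) : is_iso a ->
    exists2 b, fhom S b = a & is_iso b.
  move=> [a' [aa' a'a]]; case: (bijS X Y) => i _ iK; case: (bijS Y X) => j _ jK.
  by exists (i a); rewrite ?iK //; exists (j a'); split; apply: injS;
    rewrite fhomM fhom1 iK jK.
have [f0 ef If0] := lift _ _ _ If; have [g0 eg Ig0] := lift _ _ _ Ig.
have [h0 eh Ih0] := lift _ _ _ Ih; exists f0, g0, h0; split=> //.
move: e1 e2 e3; rewrite -ef -eg -eh !compNm !compmN -!fhomM.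
by move=> /oppr_inj/injS e1 /oppr_inj/injS e2 /oppr_inj/injS e3.
Qed.

End TriangleIso.

(** * Calculus of block rows and block columns *)

Section Blocks.
Variables (k : fieldType) (disp : Order.disp_t) (Y : orderType disp).
Local Notation blockmx := (@blockmx k Y).
Local Notation "A ** B" := (bmul A B) (at level 40, left associativity).

Lemma addd_finite (d e : Y -> nat) : finite_dim d -> finite_dim e ->
  finite_dim (fun i => d i + e i)%N.
Proof.
move=> fd fe.
have : finite_set ([set i | d i != 0%N] `|` [set i | e i != 0%N])%classic.
  by rewrite finite_setU.
apply: sub_finite_set => i /=; rewrite addn_eq0 negb_and.
by move=> /orP.
Qed.

Section RowCol.
Variables d d1 d2 e e1 e2 : Y -> nat.

(** Juxtaposition takes place inside each block, as in [cone_bmx], so that the matrix of a cone is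
    convertible to a [bcol] of [brow]s. *)
Definition brow (A : blockmx d e1) (B : blockmx d e2) :
    blockmx d (fun j => e1 j + e2 j)%N := fun i j => row_mx (A i j) (B i j).

Definition bcol (A : blockmx d1 e) (B : blockmx d2 e) :
    blockmx (fun i => d1 i + d2 i)%N e := fun i j => col_mx (A i j) (B i j).

Lemma browD A A' B B' : brow A B + brow A' B' = brow (A + A') (B + B').
Proof. by apply: bmxP => i j; exact: add_row_mx. Qed.

Lemma bcolD A A' B B' : bcol A B + bcol A' B' = bcol (A + A') (B + B').
Proof. by apply: bmxP => i j; exact: add_col_mx. Qed.

Lemma browN A B : - brow A B = brow (- A) (- B).
Proof. by apply: bmxP => i j; exact: opp_row_mx. Qed.

Lemma bcolN A B : - bcol A B = bcol (- A) (- B).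
Proof. by apply: bmxP => i j; exact: opp_col_mx. Qed.

Lemma brow0 : 0 = brow 0 0.
Proof. by apply: bmxP => i j; rewrite /brow row_mx0. Qed.

Lemma bcol0 : 0 = bcol 0 0.
Proof. by apply: bmxP => i j; rewrite /bcol col_mx0. Qed.

Lemma brow_split (A : blockmx d (fun j => e1 j + e2 j)%N) :
  exists A1 A2, A = brow A1 A2.
Proof.
exists (fun i j => lsubmx (A i j)), (fun i j => rsubmx (A i j)).
by apply: bmxP => i j; rewrite /brow hsubmxK.
Qed.

Lemma brow_inj A A' B B' : brow A B = brow A' B' -> A = A' /\ B = B'.
Proof.
move=> e0; split; apply: bmxP => i j;
  by have /eq_row_mx[] : row_mx (A i j) (B i j) = row_mx (A' i j) (B' i j);
  rewrite -?[LHS]/(brow A B i j) ?e0.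
Qed.

End RowCol.

Lemma bid_add (d1 d2 : Y -> nat) :
  bid k (fun i => d1 i + d2 i)%N = bcol (brow (bid k d1) 0) (brow 0 (bid k d2)).
Proof.
apply: bmxP => i j; rewrite /bcol /brow; have [<-|ij] := eqVneq i j.
  by rewrite !bid_diag -[RHS]scalar_mx_block.
by rewrite !bid_off // -[RHS]/(block_mx 0 0 0 0) block_mx0.
Qed.

Lemma bmul_row (d e f1 f2 : Y -> nat) (A : blockmx d e) (B : blockmx e f1)
    (C : blockmx e f2) :
  finite_dim e -> A ** brow B C = brow (A ** B) (A ** C).
Proof.
move=> /finite_dimP[X eX]; apply: bmxP => i j.
rewrite /brow !(bmulE _ _ _ _ eX).
under eq_bigr do rewrite mul_mx_row.
elim/big_ind3: _ => //= [|a a' b b' c c' -> ->]; first by rewrite row_mx0.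
by rewrite add_row_mx.
Qed.

Lemma bmul_col (d1 d2 e f : Y -> nat) (A : blockmx d1 e) (B : blockmx d2 e)
    (C : blockmx e f) :
  finite_dim e -> bcol A B ** C = bcol (A ** C) (B ** C).
Proof.
move=> /finite_dimP[X eX]; apply: bmxP => i j.
rewrite /bcol !(bmulE _ _ _ _ eX).
under eq_bigr do rewrite mul_col_mx.
elim/big_ind3: _ => //= [|a a' b b' c c' -> ->]; first by rewrite col_mx0.
by rewrite add_col_mx.
Qed.

Lemma bmul_row_col (d e1 e2 f : Y -> nat) (A : blockmx d e1) (B : blockmx d e2)
    (C : blockmx e1 f) (D : blockmx e2 f) :
  finite_dim e1 -> finite_dim e2 -> brow A B ** bcol C D = A ** C + B ** D.
Proof.
move=> /finite_dimP[X1 e1X] /finite_dimP[X2 e2X]; apply: bmxP => i j.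
(* One finite support serves for all three sums. *)
have e1U l : l \notin (X1 `|` X2)%fset -> e1 l = 0%N.
  by rewrite inE negb_or => /andP[/e1X].
have e2U l : l \notin (X1 `|` X2)%fset -> e2 l = 0%N.
  by rewrite inE negb_or => /andP[_ /e2X].
have eU l : l \notin (X1 `|` X2)%fset -> (e1 l + e2 l)%N = 0%N.
  by move=> lU; rewrite e1U ?e2U.
rewrite bmxDE (bmulE _ _ _ _ e1U) (bmulE _ _ _ _ e2U) (bmulE _ _ _ _ eU).
by rewrite -big_split; apply: eq_bigr => l _; exact: mul_row_col.
Qed.

Lemma brow_bcol (d1 d2 e1 e2 : Y -> nat) (A : blockmx d1 e1)
    (B : blockmx d1 e2) (C : blockmx d2 e1) (D : blockmx d2 e2) :
  brow (bcol A C) (bcol B D) = bcol (brow A B) (brow C D).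
Proof. by apply: bmxP => i j; rewrite /brow /bcol -block_mxEh. Qed.

(** A zero block spanning two bands must be split before [brow_bcol] can apply. *)
Lemma brow_0bcol (d1 d2 e1 e2 : Y -> nat) (B : blockmx d1 e2)
    (D : blockmx d2 e2) :
  brow (0 : blockmx _ e1) (bcol B D) = bcol (brow 0 B) (brow 0 D).
Proof. by rewrite [X in brow X]bcol0 brow_bcol. Qed.

Lemma brow_bcol0 (d1 d2 e1 e2 : Y -> nat) (A : blockmx d1 e1)
    (C : blockmx d2 e1) :
  brow (bcol A C) (0 : blockmx _ e2) = bcol (brow A 0) (brow C 0).
Proof. by rewrite [X in brow _ X]bcol0 brow_bcol. Qed.

(** * Closure properties of admissible matrices *)

Section Admissible.
Variable sigma : Y -> Y.

(** These two conditions are common to morphisms and to homotopies, so one set of closure lemmas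
    serves both. *)
Definition admissible d e (T : blockmx d e) : Prop :=
  upper_triangular T /\ sigma_diag sigma T.

Definition sigma_dim (d : Y -> nat) : Prop := forall i j, sigma i = j -> d i = d j.

Lemma adm0 d e : sigma_dim d -> sigma_dim e -> admissible (0 : blockmx d e).
Proof. by move=> sd se; split=> //; exact: sigma_diag0. Qed.

Lemma admB d e (T S : blockmx d e) :
  admissible T -> admissible S -> admissible (T - S).
Proof.
by move=> [T1 T2] [S1 S2]; split; [exact: upper_triangularB|exact: sigma_diagB].
Qed.

Lemma admN d e (T : blockmx d e) : sigma_dim d -> sigma_dim e ->
  admissible T -> admissible (- T).
Proof. by move=> sd se hT; rewrite -[- T]add0r; apply: admB => //; exact: adm0. Qed.

Lemma admM d e f (T : blockmx d e) (S : blockmx e f) :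
  admissible T -> admissible S -> admissible (T ** S).
Proof.
by move=> [T1 T2] [S1 S2]; split; [exact: upper_triangularM|exact: sigma_diagM].
Qed.

Lemma adm1 d : sigma_dim d -> admissible (bid k d).
Proof. by move=> sd; split; [exact: upper_triangular1|exact: sigma_diag1]. Qed.

Lemma adm_row d e1 e2 (A : blockmx d e1) (B : blockmx d e2) :
  admissible A -> admissible B -> admissible (brow A B).
Proof.
move=> [A1 A2] [B1 B2]; split.
  by move=> i j ji; rewrite /brow A1 // B1 // row_mx0.
move=> i j ij; move: (A2 i j ij) (B2 i j ij); rewrite /brow /eq_mx.
(* Generalising the diagonal blocks, then their sizes, makes the size equalities relate variables;
   [subst] then turns the casts into identities. *)
move: (A i i) (A j j) (B i i) (B j j).
move: (d i) (d j) (e1 i) (e1 j) (e2 i) (e2 j) => m m' n n' p p'.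
move=> a a' b b' [[x y] <-] [[z t] <-]; subst m' n' p'.
by exists (erefl, erefl); rewrite !castmx_id.
Qed.

Lemma adm_col d1 d2 e (A : blockmx d1 e) (B : blockmx d2 e) :
  admissible A -> admissible B -> admissible (bcol A B).
Proof.
move=> [A1 A2] [B1 B2]; split.
  by move=> i j ji; rewrite /bcol A1 // B1 // col_mx0.
move=> i j ij; move: (A2 i j ij) (B2 i j ij); rewrite /bcol /eq_mx.
move: (A i i) (A j j) (B i i) (B j j).
move: (d1 i) (d1 j) (d2 i) (d2 j) (e i) (e j) => m m' n n' p p'.
move=> a a' b b' [[x y] <-] [[z t] <-]; subst m' n' p'.
by exists (erefl, erefl); rewrite !castmx_id.
Qed.

End Admissible.
End Blocks.

(** * Matrix representatives of morphisms *)

Section Kappa.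
Variables (k : fieldType) (disp : Order.disp_t) (Y : orderType disp).
Variable sigma : Y -> Y.
Local Notation "A ** B" := (bmul A B) (at level 40, left associativity).
Local Notation blockmx := (@blockmx k Y).
Local Notation sobj := (@sobj k disp Y sigma).
Local Notation kappa_cat := (@kappa_cat k disp Y sigma).
Local Notation kappa_shift := (@kappa_shift k disp Y sigma).
Local Notation bid := (bid k).

Local Ltac fin := by repeat first
  [exact: dim_finite | exact: cone_dim_finite | apply: addd_finite].

Local Ltac assocl := repeat (rewrite bmulA; [|fin|fin]).
Local Ltac assocr := repeat (rewrite -bmulA; [|fin|fin]).
Local Ltac dist := repeat first [rewrite bmulDl; [|fin] | rewrite bmulDr; [|fin]
  | rewrite bmulNl; [|fin] | rewrite bmulNr; [|fin]].

Definition kpi (B C : sobj) (T : smor B C) : hom (p := kappa_cat) B C :=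
  qpi (null_ideal k sigma) (A := B) (B := C) T.

Lemma kpi_repr (B C : sobj) (f : hom (p := kappa_cat) B C) : exists T, f = kpi T.
Proof. by exists (qrepr f); rewrite /kpi qreprK. Qed.

Lemma kpi_eq (B C : sobj) (T S : smor B C) :
  kpi T = kpi S <-> exists2 K : blockmx (dim B) (dim C), admissible sigma K &
    mx_of T - mx_of S = bmx B ** K + K ** bmx C.
Proof.
rewrite /kpi; split.
  by move=> /qpiP/asboolP[K [K1 K2 K3]]; exists K.
by move=> [K [K2 K3] K1]; apply/qpiP/asboolP; exists K; split.
Qed.

Lemma kpi_comp (B C D : sobj) (T : smor B C) (S : smor C D) :
  kpi (smor_comp T S) = kpi T ;; kpi S.
Proof. exact: (@qpi_comp _ (null_ideal k sigma) B C D T S). Qed.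

Lemma kpi_shift (B C : sobj) (T : smor B C) :
  fhom kappa_shift (kpi T) = kpi (shift_mor T).
Proof.
exact: (quot_fhomE (@s_shift_additive k disp Y sigma)
  (@s_shift_null k disp Y sigma)).
Qed.

Lemma kpiD (B C : sobj) (T S : smor B C) : kpi (T + S) = kpi T + kpi S.
Proof. exact: (@qpiD _ (null_ideal k sigma) B C). Qed.

Lemma kpi0 (B C : sobj) : kpi (0 : smor B C) = 0.
Proof. by apply: (addIr (kpi 0)); rewrite -kpiD !add0r. Qed.

Lemma kpiN (B C : sobj) (T : smor B C) : kpi (- T) = - kpi T.
Proof. by apply: (addIr (kpi T)); rewrite -kpiD !addNr kpi0. Qed.

Lemma kpi1 (B : sobj) : kpi (smor_id B) = idm (B : kappa_cat).
Proof. by []. Qed.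

Lemma smor_adm (B C : sobj) (T : smor B C) : admissible sigma (mx_of T).
Proof. by case: (smorP T). Qed.

Lemma smor_comm (B C : sobj) (T : smor B C) : mx_of T ** bmx C = bmx B ** mx_of T.
Proof. by case: (smorP T). Qed.

(** The existential form keeps the proof that [T] is a morphism out of later terms and leaves only
    the equation for the matrix. *)
Lemma smor_exists (B C : sobj) (T : blockmx (dim B) (dim C)) :
  T ** bmx C = bmx B ** T -> admissible sigma T ->
  exists S : smor B C, mx_of S = T.
Proof.
move=> e [T1 T2]; have hT : is_smor T by split.
by exists (smor_of hT).
Qed.

Lemma cone_bmxE (B C : sobj) (T : smor B C) :
  bmx (cone T) = bcol (brow (- bmx B) (mx_of T)) (brow 0 (bmx C)).
Proof. by []. Qed.

Lemma cone_inE (B C : sobj) (T : smor B C) :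
  mx_of (cone_in T) = brow 0 (bid (dim C)).
Proof. by []. Qed.

Lemma cone_outE (B C : sobj) (T : smor B C) :
  mx_of (cone_out T) = bcol (bid (dim B)) 0.
Proof. by []. Qed.

Lemma sdim (B : sobj) : sigma_dim sigma (dim B).
Proof. exact: dim_sigma. Qed.

Local Ltac adm := repeat first
  [ exact: smor_adm
  | match goal with |- admissible _ (mx_of ?T) => exact: (smor_adm T) end
  | exact: adm1 (@sdim _) | exact: adm0 (@sdim _) (@sdim _) | exact: sdim | by []
  | apply: adm_row | apply: adm_col | apply: admN | apply: admB | apply: admM ].

Lemma smor_compE (B C D : sobj) (T : smor B C) (S : smor C D) :
  mx_of (smor_comp T S) = mx_of T ** mx_of S.
Proof. by []. Qed.

Lemma mx_ofN (B C : sobj) (T : smor B C) : mx_of (- T) = - mx_of T.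
Proof. by []. Qed.

Lemma shift_morE (B C : sobj) (T : smor B C) : mx_of (shift_mor T) = mx_of T.
Proof. by []. Qed.

Lemma kpi_compE (B C D : sobj) (T : smor B C) (S : smor C D) (R : smor B D) :
  mx_of T ** mx_of S = mx_of R -> kpi T ;; kpi S = kpi R.
Proof. by move=> e; rewrite -kpi_comp; congr kpi; apply: mx_of_inj. Qed.

Lemma kpi_comp_sq (B C C' D : sobj) (T : smor B C) (S : smor C D)
    (T' : smor B C') (S' : smor C' D) :
  mx_of T ** mx_of S = mx_of T' ** mx_of S' -> kpi T ;; kpi S = kpi T' ;; kpi S'.
Proof. by move=> e; rewrite -!kpi_comp; congr kpi; apply: mx_of_inj. Qed.

Lemma smor_idE (B : sobj) : mx_of (smor_id B) = bid (dim B).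
Proof. by []. Qed.

Lemma bid_cone (B C : sobj) (T : smor B C) :
  bid (dim (cone T)) = bcol (brow (bid (dim B)) 0) (brow 0 (bid (dim C))).
Proof. exact: bid_add. Qed.

(* Multiplies out block matrices, with the nested blocks in the normal form of a
   [bcol] of [brow]s and zero blocks contracted. *)
Local Ltac blk := rewrite ?smor_idE ?bid_cone;
  repeat first
  [ progress rewrite ?(bmul0l, bmul0r, bmul1l, bmul1r)
      ?(addr0, add0r, oppr0, opprK, addNr, addrN)
  | rewrite bmul_row_col; [|fin|fin] | rewrite bmul_col; [|fin]
  | rewrite bmul_row; [|fin] | rewrite bmulNl; [|fin] | rewrite bmulNr; [|fin]
  | rewrite browD | rewrite bcolD | rewrite browN | rewrite bcolN
  | rewrite brow_bcol | rewrite brow_0bcol | rewrite brow_bcol0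
  | progress rewrite -?brow0 -?bcol0 ].

Lemma cone_map (B C B' C' : sobj) (T : smor B C) (T' : smor B' C')
    (f : smor B B') (g : smor C C') :
  kpi T ;; kpi g = kpi f ;; kpi T' ->
  exists h : smor (cone T) (cone T'),
    kpi (cone_in T) ;; kpi h = kpi g ;; kpi (cone_in T') /\
    kpi (cone_out T) ;; fhom kappa_shift (kpi f) = kpi h ;; kpi (cone_out T').
Proof.
rewrite kpi_shift -!kpi_comp => /kpi_eq[K Kadm eK]; rewrite !smor_compE in eK.
pose H : blockmx (dim (cone T)) (dim (cone T')) :=
  bcol (brow (mx_of f) K) (brow 0 (mx_of g)).
have [||h eh] := @smor_exists (cone T) (cone T') H.
- rewrite /H !cone_bmxE; blk; rewrite !smor_comm; congr (bcol (brow _ _) _).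
  (* Only the upper right block is left: f T' + K C' = -B K + T g, the homotopy equation
     rearranged. *)
  by move/eqP: eK; rewrite subr_eq => /eqP ->; rewrite -!addrA addKr addrC.
- by rewrite /H; adm.
by exists h; rewrite ?kpi_comp; split; apply: kpi_comp_sq;
  rewrite eh /H ?cone_inE ?cone_outE; blk.
Qed.

Lemma cone_out_exact (B C W : sobj) (T : smor B C)
    (phi : hom (p := kappa_cat) W (cone T)) :
  phi ;; kpi (cone_out T) = 0 -> exists psi, phi = psi ;; kpi (cone_in T).
Proof.
have [p ->] := kpi_repr phi; rewrite -kpi0 -kpi_comp => /kpi_eq[].
rewrite -[dim (shift_obj B)]/(dim B) => K Kadm.
rewrite smor_compE mx_of0 cone_outE subr0.
have [p1 [p2 ep]] := @brow_split k _ Y (dim W) (dim B) (dim C) (mx_of p).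
rewrite ep; blk => ep1.
have := smor_comm p; rewrite ep cone_bmxE; blk => /brow_inj[e1 e2].
(* Multiplication by [bcol 0 1] extracts the second component of [p], so [s] is p2 - K T. *)
have [||s es] := @smor_exists W C
  (mx_of p ** bcol 0 (bid (dim C)) - K ** mx_of T).
- rewrite ep; blk; dist; assocr; rewrite smor_comm -e2 ep1; dist; assocl.
  by rewrite [RHS]addrAC [_ - _ - _]addrAC subrr add0r addrC.
- adm.
(* The boundary of (K, 0) is (W K - K B, K T) = (p1, K T), which is (p1, p2) - (0, p2 - K T). *)
exists (kpi s); rewrite -kpi_comp; apply/kpi_eq; exists (brow K 0); first by adm.
rewrite smor_compE es cone_inE cone_bmxE ep; blk.
by rewrite ep1 opprB addrCA subrr addr0.
Qed.

Lemma cone_endo_iso (B C : sobj) (T : smor B C)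
    (e : hom (p := kappa_cat) (cone T) (cone T)) :
  kpi (cone_in T) ;; e = kpi (cone_in T) ->
  e ;; kpi (cone_out T) = kpi (cone_out T) -> is_iso e.
Proof.
move=> in_e e_out; apply: is_iso_unipotent.
(* Only the first factor e - 1 is rewritten, as [psi] followed by [cone_in T]; the second factor
   kills it because [e] fixes [cone_in T]. *)
have [|psi {1}->] := @cone_out_exact _ _ _ T (e - idm _).
  by rewrite compBl comp1m e_out subrr.
by rewrite -compA compBr in_e compm1 subrr compm0.
Qed.

(** The maps of cones obtained from (f, g) and from the inverse pair depend on chosen homotopies and
    need not be mutually inverse. Both composites, however, fix the inclusion and the projection,
    hence are isomorphisms. *)
Lemma cone_iso (B C B' C' : sobj) (T : smor B C) (T' : smor B' C')
    (f : hom (p := kappa_cat) B B') (g : hom (p := kappa_cat) C C') :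
  is_iso f -> is_iso g -> kpi T ;; g = f ;; kpi T' ->
  exists h : hom (p := kappa_cat) (cone T) (cone T'), [/\ is_iso h,
    kpi (cone_in T) ;; h = g ;; kpi (cone_in T') &
    kpi (cone_out T) ;; fhom kappa_shift f = h ;; kpi (cone_out T')].
Proof.
move=> [f' [ff' f'f]] [g' [gg' g'g]] sq.
have sq' : kpi T' ;; g' = f' ;; kpi T.
  by rewrite -[kpi T']comp1m -f'f -(compA f') -sq -!compA gg' compm1.
have [[f0 ef] [g0 eg]] := (kpi_repr f, kpi_repr g).
have [[f1 ef'] [g1 eg']] := (kpi_repr f', kpi_repr g').
move: sq; rewrite ef eg => /cone_map[h]; rewrite -ef -eg => -[h1 h2].
move: sq'; rewrite ef' eg' => /cone_map[h']; rewrite -ef' -eg' => -[h1' h2'].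
exists (kpi h); split=> //.
apply: (is_iso_split (g := kpi h')); apply: cone_endo_iso.
- by rewrite compA h1 -compA h1' compA gg' comp1m.
- by rewrite -compA -h2' compA -h2 -compA -(fhomM kappa_shift) ff' fhom1 compm1.
- by rewrite compA h1' -compA h1 compA g'g comp1m.
- by rewrite -compA -h2 compA -h2' -compA -(fhomM kappa_shift) f'f fhom1 compm1.
Qed.

(** * Distinguished triangles over a given base *)

Local Notation distinguished := (@distinguished k disp Y sigma).

Lemma standard_isoE (X A Z : kappa_cat) (u : hom X A) (v : hom A Z)
    (w : hom Z (kappa_shift X)) (B C : sobj) (T : smor B C) :
  triangle_iso (Triangle u v w) (standard_triangle T) =
  exists (f : hom X (B : kappa_cat)) (g : hom A (C : kappa_cat))
    (h : hom Z (cone T : kappa_cat)),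
    [/\ is_iso f, is_iso g & is_iso h] /\
    [/\ u ;; g = f ;; kpi T, v ;; h = g ;; kpi (cone_in T) &
        w ;; fhom kappa_shift f = h ;; kpi (cone_out T)].
Proof. by []. Qed.

Lemma distinguishedP (B C Z : sobj) (T : smor B C)
    (v : hom (p := kappa_cat) C Z)
    (w : hom (p := kappa_cat) Z (kappa_shift B)) :
  distinguished (Triangle (kpi T) v w) <->
  exists h : hom (p := kappa_cat) Z (cone T),
    [/\ is_iso h, v ;; h = kpi (cone_in T) & w = h ;; kpi (cone_out T)].
Proof.
split=> [|[h [Ih eh1 eh2]]]; last first.
  exists B, C, T; rewrite standard_isoE; exists (idm _), (idm _), h; 
  split; first by split=> //; exact: is_iso_id.
  by split; rewrite ?comp1m ?compm1 ?fhom1 ?compm1.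
move=> [B' [C' [T']]]; rewrite standard_isoE.
move=> [f [g [h [[If Ig Ih] [e1 e2 e3]]]]].
have [[f' [ff' f'f]] [g' [gg' g'g]]] := (If, Ig).
(* The inverses of the base isomorphisms extend to a map from the cone of [T'] to that of [T];
   following [h] by it makes the isomorphism the identity on the base. *)
have [|||h' [Ih' e2' e3']] := @cone_iso _ _ _ _ T' T f' g'.
- by exists f.
- by exists g.
- by rewrite -[LHS]comp1m -f'f -(compA f') (compA f) -e1 -!compA gg' compm1.
exists (h ;; h'); split; first exact: is_iso_comp.
  by rewrite compA e2 -compA e2' compA gg' comp1m.
by rewrite -compA -e3' compA -e3 -compA -(fhomM kappa_shift) ff' fhom1 compm1.
Qed.

(** * The shift and the additive structure *)

Lemma kappa_shift_additive : additive_functor kappa_shift.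
Proof.
move=> B C f g; have [[f0 ->] [g0 ->]] := (kpi_repr f, kpi_repr g).
by rewrite -kpiD !kpi_shift -kpiD; congr kpi; apply: mx_of_inj.
Qed.

Lemma shift_objK : involutive (@shift_obj k disp Y sigma).
Proof.
case=> d b fd sd b0; rewrite /shift_obj /=.
(* The type of this proof mentions [- - b], so it is generalised before [opprK]; proof irrelevance
   then identifies it with [b0]. *)
move: (shift_sq0 _) => /=; rewrite opprK => b0'.
by rewrite (Prop_irrelevance b0' b0).
Qed.

Lemma shift_mor_surj (B C : sobj) (T : smor (shift_obj B) (shift_obj C)) :
  exists S : smor B C, T = shift_mor S.
Proof.
have [||S eS] := @smor_exists B C (mx_of T).
- by have := smor_comm T; rewrite /= bmulNr ?bmulNl => [/oppr_inj||]; try fin.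
- exact: smor_adm T.
by exists S; apply: mx_of_inj.
Qed.

Lemma kappa_shift_auto : autofunctor kappa_shift.
Proof.
split=> [|B C]; first by exists (@shift_obj k disp Y sigma); exact: shift_objK.
have injS : injective (@fhom _ _ kappa_shift B C).
  move=> f g; have [[f0 ->] [g0 ->]] := (kpi_repr f, kpi_repr g).
  rewrite !kpi_shift => /kpi_eq[].
  rewrite -[dim (shift_obj B)]/(dim B) -[dim (shift_obj C)]/(dim C) => K Kadm eK.
  (* The shift changes the sign of both differentials, hence that of the homotopy. *)
  apply/kpi_eq; exists (- K); first by adm.
  by rewrite [LHS]eK /= !bmulNl ?bmulNr //; fin.
have surjS (g : hom (kappa_shift B) (kappa_shift C)) :
    {f | fhom kappa_shift f = g}.
  apply: cid; have [g0 ->] := @kpi_repr (shift_obj B) (shift_obj C) g.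
  by have [S ->] := shift_mor_surj g0; exists (kpi S); rewrite kpi_shift.
exists (fun g => sval (surjS g)) => [f|g]; last by case: (surjS g).
by apply: injS; case: (surjS _).
Qed.

Lemma kappa_additive : additive_category kappa_cat.
Proof.
split=> [|A B].
  have fd : finite_dim (fun _ : Y => 0%N).
    by apply: (sub_finite_set (B := set0)) => // i /=; rewrite eqxx.
  exists (@SObj k disp Y sigma (fun _ => 0%N) 0 fd
    (fun _ _ _ => erefl) (bmul0l _ _)).
  apply: is_zero_id0; rewrite -kpi0 -kpi1; congr kpi; apply: mx_of_inj.
  by apply: bmxP => i j; exact: flatmx0.
(* The signs of the shift and of the cone cancel, so this cone has matrix diag(A, B) and is the
   direct sum. The projection to [A] is built by hand, since [cone_out] lands in the double shift of
   [A]. *)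
pose P := cone (0 : smor (shift_obj A) B).
have [||i1 ei1] := @smor_exists A P (brow (bid (dim A)) 0).
- by rewrite cone_bmxE; blk.
- by adm.
have [||p1 ep1] := @smor_exists P A (bcol (bid (dim A)) 0).
- by rewrite cone_bmxE; blk.
- by adm.
have [||p2 ep2] := @smor_exists P B (bcol 0 (bid (dim B))).
- by rewrite cone_bmxE; blk.
- by adm.
exists P, (kpi i1), (kpi (cone_in 0)), (kpi p1), (kpi p2); split.
- by rewrite -kpi1; apply: kpi_compE; rewrite ei1 ep1; blk.
- by rewrite -kpi1; apply: kpi_compE; rewrite ep2 cone_inE; blk.
rewrite -!kpi_comp -kpiD -kpi1; congr kpi; apply: mx_of_inj.
by rewrite mx_ofD !smor_compE ei1 ep1 ep2 cone_inE; blk.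
Qed.

Lemma cone_id_zero (B : sobj) : is_zero (cone (smor_id B) : kappa_cat).
Proof.
apply: is_zero_id0; rewrite -kpi0 -kpi1; apply/kpi_eq.
(* With D the matrix of the cone and K this contraction, D K = [[1, 0], [B, 0]] and K D = [[0, 0],
   [-B, 1]]. *)
exists (bcol (brow 0 0) (brow (bid (dim B)) 0)); first by adm.
rewrite cone_bmxE mx_of0 subr0.
by blk.
Qed.

(** * Identity triangles and rotation *)

Lemma distinguished_iso (t t' : triangle kappa_shift) :
  triangle_iso t t' -> distinguished t -> distinguished t'.
Proof.
move=> /triangle_iso_sym tt' [B [C [T hT]]]; exists B, C, T.
exact: triangle_iso_trans tt' hT.
Qed.

Lemma distinguished_id (X Z : kappa_cat) : is_zero Z ->
  distinguished (Triangle (idm X) (0 : hom X Z) (0 : hom Z (kappa_shift X))).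
Proof.
move=> [iZ tZ]; rewrite -kpi1; apply/distinguishedP; exists 0.
have [iK tK] := cone_id_zero X.
split; last exact: initial_eq; last exact: terminal_eq.
by exists 0; split; [exact: initial_eq|exact: terminal_eq].
Qed.

Lemma distinguished_cone (B C : sobj) (T : smor B C) :
  distinguished (standard_triangle T).
Proof. by exists B, C, T; exact: triangle_iso_refl. Qed.

Lemma standard_rotate (B C : sobj) (T : smor B C) :
  distinguished (rotate (standard_triangle T)).
Proof.
rewrite -[rotate _]/(Triangle (C := kappa_cat) (S := kappa_shift)
  (kpi (cone_in T)) (kpi (cone_out T)) (- fhom kappa_shift (kpi T))).
apply/distinguishedP.
(* The cone of [cone_in T] has three bands, of sizes C, B and C. *)
have [||h eh] := @smor_exists (shift_obj B) (cone (cone_in T))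
  (brow (- mx_of T) (brow (bid (dim B)) 0)).
- rewrite !cone_bmxE cone_inE -[bmx (shift_obj B)]/(- bmx B).
  rewrite -[dim (shift_obj B)]/(dim B).
  by blk; rewrite smor_comm; blk.
- by adm.
have [||h' eh'] := @smor_exists (cone (cone_in T)) (shift_obj B)
  (bcol 0 (bcol (bid (dim B)) 0)).
- by rewrite !cone_bmxE cone_inE; blk.
- by adm.
exists (kpi h); split.
- exists (kpi h'); split.
    by rewrite -kpi1; apply: kpi_compE; rewrite eh eh'; blk.
  rewrite -kpi1 -kpi_comp; apply/kpi_eq.
  (* The entry -1 from the last copy of C to the first contracts these two bands against each
     other. *)
  exists (bcol (brow 0 (brow 0 0))
    (bcol (brow 0 (brow 0 0)) (brow (- bid (dim C)) (brow 0 0)))); first by adm.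
  by rewrite smor_compE eh eh' !cone_bmxE cone_inE; blk.
- rewrite -kpi_comp; apply/kpi_eq.
  (* These are the last two bands of the previous homotopy. *)
  exists (bcol (brow 0 (brow 0 0)) (brow (- bid (dim C)) (brow 0 0)));
    first by adm.
  by rewrite smor_compE eh !cone_bmxE !cone_inE cone_outE; blk.
rewrite kpi_shift -kpiN; symmetry; apply: kpi_compE.
by rewrite eh cone_outE; blk.
Qed.

Lemma standard_shift (B C : sobj) (T : smor B C) :
  triangle_iso (shift_triangle (standard_triangle T))
    (standard_triangle (shift_mor T)).
Proof.
rewrite -[shift_triangle _]/(Triangle (C := kappa_cat) (S := kappa_shift)
  (- fhom kappa_shift (kpi T)) (- fhom kappa_shift (kpi (cone_in T)))
  (- fhom kappa_shift (kpi (cone_out T)))) standard_isoE.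
pose H : blockmx (fun i => dim B i + dim C i)%N (fun i => dim B i + dim C i)%N :=
  bcol (brow (- bid (dim B)) 0) (brow 0 (bid (dim C))).
have Hadm : admissible sigma H by rewrite /H; adm.
have [|//|h eh] := @smor_exists (shift_obj (cone T)) (cone (shift_mor T)) H.
  rewrite cone_bmxE -[bmx (shift_obj (cone T))]/(- bmx (cone T)) cone_bmxE.
  rewrite -[bmx (shift_obj B)]/(- bmx B) -[bmx (shift_obj C)]/(- bmx C).
  by rewrite -[mx_of (shift_mor T)]/(mx_of T) /H; blk.
have [|//|h' eh'] := @smor_exists (cone (shift_mor T)) (shift_obj (cone T)) H.
  rewrite cone_bmxE -[bmx (shift_obj (cone T))]/(- bmx (cone T)) cone_bmxE.
  rewrite -[bmx (shift_obj B)]/(- bmx B) -[bmx (shift_obj C)]/(- bmx C).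
  by rewrite -[mx_of (shift_mor T)]/(mx_of T) /H; blk.
have HH : H ** H = bid (dim (cone T)) by rewrite /H; blk.
(* The sign on the middle vertex cancels those of the first two edges; the entry -1 of [H] on B
   cancels that of the third. *)
exists (idm _), (- idm _), (kpi h); split; split.
- exact: is_iso_id.
- by apply: is_isoN; exact: is_iso_id.
- by exists (kpi h'); split; rewrite -kpi1; apply: kpi_compE; rewrite eh eh'.
- by rewrite compNm compmN opprK compm1 comp1m kpi_shift.
- rewrite kpi_shift compNm compNm comp1m; congr (- _); apply: kpi_compE.
  by rewrite eh /H shift_morE !cone_inE; blk.
rewrite fhom1 compm1 kpi_shift -kpiN; symmetry; apply: kpi_compE.
by rewrite eh /H mx_ofN shift_morE !cone_outE; blk.
Qed.

Lemma distinguished_rotate (t : triangle kappa_shift) :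
  distinguished t -> distinguished (rotate t).
Proof.
move=> [B [C [T /rotate_iso/triangle_iso_sym]]].
by move=> /distinguished_iso; apply; exact: standard_rotate.
Qed.

Lemma distinguished_rotateE (t : triangle kappa_shift) :
  distinguished t <-> distinguished (rotate t).
Proof.
split; first exact: distinguished_rotate.
move=> /distinguished_rotate/distinguished_rotate.
rewrite rotate3 => -[B' [C' [T']]].
(* Once its ends are written as double shifts, [T'] is itself the shift of a matrix, so
   [standard_shift] applies. *)
rewrite -(shift_objK B') -(shift_objK C') in T' *.
have [T ->] := shift_mor_surj T'.
move=> /triangle_iso_trans/(_ (triangle_iso_sym (standard_shift T))) tT.
exists (shift_obj B'), (shift_obj C'), T.
by apply: shift_triangle_iso tT; [exact: kappa_shift_additive|exact: kappa_shift_auto].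
Qed.

(** * Morphisms of triangles and the octahedron *)

Lemma distinguished_map (X A Z X' A' Z' : kappa_cat)
    (u : hom X A) (v : hom A Z) (w : hom Z (kappa_shift X))
    (u' : hom X' A') (v' : hom A' Z') (w' : hom Z' (kappa_shift X'))
    (f : hom X X') (g : hom A A') :
  distinguished (Triangle u v w) -> distinguished (Triangle u' v' w') ->
  u ;; g = f ;; u' ->
  exists h : hom Z Z', v ;; h = g ;; v' /\ w ;; fhom kappa_shift f = h ;; w'.
Proof.
have [[u0 ->] [u0' ->]] := (kpi_repr u, kpi_repr u').
have [[f0 ->] [g0 ->]] := (kpi_repr f, kpi_repr g).
move=> /distinguishedP[h [_ e1 ->]] /distinguishedP[h' [[k' [hk' kh']] e1' ->]].
move=> /cone_map[m [m1 m2]]; exists (h ;; kpi m ;; k'); split.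
  by rewrite !compA e1 m1 -e1' -!compA hk' compm1.
by rewrite -!compA (compA k') kh' comp1m m2.
Qed.

Lemma standard_octahedron (X A Z : sobj) (u : smor X A) (v : smor A Z) :
  exists (f : hom (p := kappa_cat) (cone u) (cone (smor_comp u v)))
    (g : hom (p := kappa_cat) (cone (smor_comp u v)) (cone v)),
    distinguished (Triangle (S := kappa_shift) f g
      (kpi (cone_out v) ;; fhom kappa_shift (kpi (cone_in u)))) /\
    [/\ kpi (cone_in u) ;; f = kpi v ;; kpi (cone_in (smor_comp u v)),
        f ;; kpi (cone_out (smor_comp u v)) = kpi (cone_out u),
        kpi (cone_in (smor_comp u v)) ;; g = kpi (cone_in v) &
        g ;; kpi (cone_out v) =
          kpi (cone_out (smor_comp u v)) ;; fhom kappa_shift (kpi u)].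
Proof.
have [||f ef] := @smor_exists (cone u) (cone (smor_comp u v))
  (bcol (brow (bid (dim X)) 0) (brow 0 (mx_of v))).
- by rewrite !cone_bmxE smor_compE; blk; rewrite smor_comm.
- by adm.
have [||g eg] := @smor_exists (cone (smor_comp u v)) (cone v)
  (bcol (brow (mx_of u) 0) (brow 0 (bid (dim Z)))).
- by rewrite !cone_bmxE smor_compE; blk; rewrite smor_comm.
- by adm.
exists (kpi f), (kpi g); rewrite !kpi_shift; split; last first.
  split; [apply: kpi_comp_sq|apply: kpi_compE|apply: kpi_compE|apply: kpi_comp_sq];

  rewrite ?shift_morE ?ef ?eg ?cone_inE ?cone_outE; by blk.
rewrite -kpi_comp; apply/distinguishedP.
(* The cone of [f] has bands X, A, X, Z; [h] places the cone of [v] in the second and fourth. *)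
have [||h eh] := @smor_exists (cone v) (cone f)
  (bcol (brow (brow 0 (bid (dim A))) 0) (brow 0 (brow 0 (bid (dim Z))))).
- by rewrite !cone_bmxE ef smor_compE; blk.
- by adm.
have [||h' eh'] := @smor_exists (cone f) (cone v)
  (bcol (bcol 0 (brow (bid (dim A)) 0))
    (bcol (brow (mx_of u) 0) (brow 0 (bid (dim Z))))).
- rewrite !cone_bmxE ef smor_compE; blk. by rewrite smor_comm.
- by adm.
have hh' : kpi h' ;; kpi h = idm _.
  rewrite -kpi_comp -kpi1; apply/kpi_eq.
  (* The entry -1 from the second copy of X to the first contracts the two copies; its boundary also
     accounts for the entry u of [h']. *)
  exists (- bcol 0 (bcol (brow (brow (bid (dim X)) 0) 0) 0)); first by adm.
  rewrite smor_compE eh eh' !cone_bmxE ef smor_compE.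
  by blk.
have hh : kpi h ;; kpi h' = idm _.
  by rewrite -kpi1; apply: kpi_compE; rewrite eh eh'; blk.
(* On matrices, g h differs in general from [cone_in f], while [cone_in f] followed by [h'] is
   exactly g; the needed identity follows by inverting [h']. *)
have in_h' : kpi (cone_in f) ;; kpi h' = kpi g.
  by apply: kpi_compE; rewrite eh' eg cone_inE; blk.
exists (kpi h); split; first by exists (kpi h').
  by rewrite -in_h' -compA hh' compm1.
symmetry; apply: kpi_compE.
by rewrite eh smor_compE shift_morE !cone_outE cone_inE; blk.
Qed.

(** The isomorphisms to the three cones given by [distinguishedP] are the identity on the bases, so
    conjugating the standard octahedron by them preserves all its relations. *)
Lemma distinguished_octahedron (X A Z X' A' Z' : kappa_cat)
    (u : hom X A) (v : hom A Z)
    (j : hom A Z') (m : hom Z' (kappa_shift X))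
    (l : hom Z X') (i : hom X' (kappa_shift A))
    (p : hom Z A') (n : hom A' (kappa_shift X)) :
  distinguished (Triangle u j m) -> distinguished (Triangle v l i) ->
  distinguished (Triangle (u ;; v) p n) ->
  exists (f : hom Z' A') (g : hom A' X'),
    distinguished (Triangle f g (i ;; fhom kappa_shift j)) /\
    [/\ j ;; f = v ;; p, f ;; n = m, p ;; g = l & g ;; i = n ;; fhom kappa_shift u].
Proof.
have [[u0 ->] [v0 ->]] := (kpi_repr u, kpi_repr v); rewrite -kpi_comp.
move=> /distinguishedP[hu [Iu eu1 eu2]] /distinguishedP[hv [Iv ev1 ev2]].
move=> /distinguishedP[hw [Iw ew1 ew2]].
have [f [g [D [e1 e2 e3 e4]]]] := standard_octahedron u0 v0.
have [[hv' [hvK hvK']] [hw' [hwK hwK']]] := (Iv, Iw).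
exists (hu ;; f ;; hw'), (hw ;; g ;; hv'); split.
  apply: distinguished_iso D; apply: triangle_iso_sym.
  apply: (triangle_isoI Iu Iw Iv).
  - by rewrite -compA hwK' compm1.
  - by rewrite -compA hvK' compm1.
  - by rewrite ev2 -eu1 fhomM !compA.
split.
- by rewrite !compA eu1 e1 -ew1 -!compA hwK compm1.
- by rewrite ew2 eu2 -e2 -!compA (compA hw') hwK' comp1m.
- by rewrite !compA ew1 e3 -ev1 -!compA hvK compm1.
- by rewrite ev2 ew2 -!compA (compA hv') hvK' comp1m e4.
Qed.
End Kappa.

Theorem theorem3p6 (k : fieldType) (disp : Order.disp_t) (Y : orderType disp)
    (sigma : Y -> Y) (sigmaK : involutive sigma) :
  @triangulated (@kappa_cat k disp Y sigma) (@kappa_shift k disp Y sigma)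
    (@distinguished k disp Y sigma).
Proof.
split.
- exact: kappa_additive.
- exact: kappa_shift_additive.
- exact: kappa_shift_auto.
- exact: distinguished_iso.
- exact: distinguished_id.
- move=> X A u; have [T ->] := kpi_repr u.
  exists (cone T), (kpi (cone_in T)), (kpi (cone_out T)).
  exact: distinguished_cone.
- by move=> X A Z u v w; exact: distinguished_rotateE.
- exact: distinguished_map.
- exact: distinguished_octahedron.
Qed.
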